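(* Let $d\ge 1$ be an integer. For every $N\in\mathbb{Z}_{\ge 0}$, $$g_d(N)=\sum_{m=1}^{2d-1}\left[\binom{2d}{m}-\binom{d}{m-d}\right]\binom{N-1}{m-1}.$$
   Context: Let $[d]=\{1,\dots,d\}$. A matrix $A\in\mathbb{R}^{d\times d}$ is a $G$-matrix of value $N\in\mathbb{R}_{\ge 0}$ if all its entries are nonnegative and $A_{1,\sigma(1)}+A_{2,\sigma(2)}+\cdots+A_{d,\sigma(d)}=N$ for every permutation $\sigma$ of $[d]$. For $N\in\mathbb{Z}_{\ge 0}$, $g_d(N)$ denotes the number of $d\times d$ $G$-matrices of value $N$ all of whose entries are integers. Binomial coefficients are read as polynomials in the upper argument: $\binom{x}{k}=\frac{x(x-1)\cdots(x-k+1)}{k!}$ for integers $k\ge 0$ (so $\binom{-1}{k}=(-1)^k$), and $\binom{x}{k}=0$ for integers $k<0$. *)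

(* Defs.v *)
From mathcomp Require Import all_boot all_order all_fingroup all_algebra.
From mathcomp Require Import finmap.
From mathcomp Require Import all_classical all_reals.

Set Implicit Arguments.
Unset Strict Implicit.
Unset Printing Implicit Defensive.

Import Order.TTheory GRing.Theory Num.Theory.

Local Open Scope classical_set_scope.
Local Open Scope ring_scope.

Definition G_matrix (R : realType) (d : nat) (N : R) (A : 'M[R]_d) : Prop :=
  (forall i j, 0 <= A i j) /\ (forall s : 'S_d, \sum_i A i (s i) = N).

Definition integral_G_matrices {R : realType} (d N : nat) : set 'M[R]_d :=
  [set A | G_matrix N%:R A /\ (forall i j, A i j \is a Num.int)].

(* The entry at (i, j) is one of the summands for the transposition of i and j,
   so it is at most N. *)
Lemma finite_integral_G_matrices (R : realType) (d N : nat) :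
  finite_set (@integral_G_matrices R d N).
Proof.
pose f (M : 'M['I_N.+1]_d) : 'M[R]_d := map_mx (fun k : 'I_N.+1 => k%:R) M.
apply: (@sub_finite_set _ _ (f @` [set: 'M['I_N.+1]_d])); last first.
  exact/finite_image/finite_finset.
move=> A [[A_ge0 A_sum] A_int].
have A_le i j : A i j <= N%:R.
  rewrite -(A_sum (tperm i j)) (bigD1 i) //= tpermL lerDl.
  exact: sumr_ge0.
have A_nat i j : exists k : 'I_N.+1, A i j == k%:R.
  have /natrP[k Ak] : A i j \is a Num.nat by rewrite natrEint A_int A_ge0.
  have kN : (k < N.+1)%N by rewrite ltnS -(ler_nat R) -Ak.
  by exists (Ordinal kN); rewrite Ak.
exists (\matrix_(i, j) xchoose (A_nat i j)) => //.
apply/matrixP => i j; rewrite !mxE.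
by rewrite -(eqP (xchooseP (A_nat i j))).
Qed.

(* [fset_set] of an infinite set is empty; the set is finite by the lemma
   above, so this is a genuine cardinality. *)
Definition g (R : realType) (d N : nat) : nat :=
  #|` fset_set (@integral_G_matrices R d N)|.

(* The binomial coefficient as a polynomial in its upper argument, with an
   integer lower argument; [Negz n] is the integer - n.+1. *)
Definition gbinom (R : realType) (x : R) (k : int) : R :=
  match k with
  | Posz n => (\prod_(i < n) (x - i%:R)) / n`!%:R
  | Negz _ => 0
  end.

(* Main.v *)
(* Comparing two permutations that differ by a transposition shows that an
   integral G-matrix satisfies A i j + A k l = A i l + A k j, hence has the form
   A i j = r i + c j with natural numbers r i, c j of total sum N; the pair
   (r, c) becomes unique when min r = 0 is imposed. Subtracting the pairs with
   all r i > 0 (shift r by 1, which lowers N by d) from all pairs gives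
     g_d(N) = C(N + 2d - 1, 2d - 1) - C(N + d - 1, 2d - 1),
   and Vandermonde's identity for polynomial binomials expands both terms, the
   summands with m = 2d cancelling. *)
Require Import Defs.
From mathcomp Require Import all_boot all_order all_fingroup all_algebra.
From mathcomp Require Import finmap ring zify.
From mathcomp Require Import all_classical all_reals.

Import GRing.Theory Num.Theory.
Local Open Scope ring_scope.

Local Arguments gbinom : simpl never.

(** * Polynomial binomial coefficients and the evaluation of the sum *)

Lemma gbinomS (R : realType) (x : R) (k : nat) :
  gbinom (x + 1) k.+1 = gbinom x k.+1 + gbinom x k.
Proof.
rewrite /gbinom big_ord_recl big_ord_recr /=.
under eq_bigr => i _.
  rewrite /bump /= (_ : x + 1 - _ = x - i%:R); last by rewrite natrD; ring.
over.
rewrite factS natrM subr0 mulrDl.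
have kf0 : k`!%:R != 0 :> R by rewrite pnatr_eq0 -lt0n fact_gt0.
have k0 : k%:R + 1 != 0 :> R by rewrite natr1 pnatr_eq0.
by rewrite -natr1; field; rewrite kf0 k0.
Qed.

Lemma gbinom0 (R : realType) (x : R) : gbinom x 0%N = 1.
Proof. by rewrite /gbinom big_ord0 fact0 divr1. Qed.

Lemma gbinom_nat (R : realType) (n k : nat) : gbinom (n%:R : R) k = 'C(n, k)%:R.
Proof.
elim: n k => [|n IHn] [|k]; rewrite ?gbinom0 ?bin0 //.
  by rewrite /gbinom big_ord_recl subr0 !mul0r.
by rewrite -natr1 gbinomS !IHn binS natrD.
Qed.

(** Induction on [a]: Pascal's rule splits the right side through [gbinomS] and each coefficient
    ['C(a.+1, _)] on the left, and the hypothesis serves at both [k.+1] and [k]. *)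
Lemma gbinom_Vandermonde (R : realType) (x : R) (a k : nat) :
  \sum_(i < k.+1) 'C(a, k - i)%:R * gbinom x i = gbinom (x + a%:R) k.
Proof.
elim: a k => [|a IHa] k.
  rewrite big_ord_recr big1 /= ?subnn ?bin0 ?mul1r ?add0r ?addr0 // => i _.
  by rewrite bin0n subn_eq0 leqNgt ltn_ord mul0r.
case: k => [|k]; first by rewrite big_ord1 bin0 mul1r !gbinom0.
rewrite -natr1 addrA gbinomS -!IHa !big_ord_recr /= !subnn !bin0.
under eq_bigr => i _.
  rewrite subSn ?binS ?natrD ?mulrDl; last exact: ltnW.
over.
rewrite big_split /= subSn // subnn binS bin0 natrD mulrDl.
under [in RHS]eq_bigr => i _.
  rewrite subSn; last exact: ltnW.
over.
by rewrite /=; ring.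
Qed.

Lemma gbinom_sum_closed_form (R : realType) (d N : nat) :
  \sum_(1 <= m < 2 * d.+1)
      (gbinom (2 * d.+1)%:R m%:Z - gbinom d.+1%:R (m%:Z - d.+1%:Z))
      * gbinom (N%:R - 1) (m%:Z - 1)
  = 'C(N + (d + d.+1), d + d.+1)%:R - 'C(N + d, d + d.+1)%:R :> R.
Proof.
have -> : (2 * d.+1 = (d + d.+1).+1)%N by lia.
rewrite big_add1 big_mkord -pred_Sn.
(* With [i = m - 1], symmetry of binomials puts the coefficients in Vandermonde form. The added top
   term [i = d + d.+1] has coefficient [1 - 1]. *)
transitivity (\sum_(i < (d + d.+1).+1)
   ('C((d + d.+1).+1, d + d.+1 - i)%:R - 'C(d.+1, d + d.+1 - i)%:R)
      * gbinom (N%:R - 1 : R) i).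
  rewrite big_ord_recr /= subnn !bin0 subrr mul0r addr0.
  apply: eq_bigr => i _; have i_lt := ltn_ord i.
  rewrite (_ : i.+1%:Z - 1 = i :> int); last by lia.
  congr ((_ - _) * _).
    by rewrite gbinom_nat -bin_sub; [congr ('C(_, _)%:R); lia | lia].
  have [di|id] := leqP d i.
    rewrite (_ : i.+1%:Z - d.+1%:Z = (i - d)%N :> int); last by lia.
    rewrite gbinom_nat -bin_sub; last by lia.
    by congr ('C(_, _)%:R); lia.
  (* For [i < d] both sides vanish: [d + d.+1 - i] exceeds [d.+1], and [i.+1 - d.+1] is a negative
     lower argument of [gbinom]. *)
  rewrite bin_small; last by lia.
  by rewrite (_ : _ - _ = Negz (d - i.+1)) //; lia.
under eq_bigr do rewrite mulrBl.
rewrite sumrB !gbinom_Vandermonde -!gbinom_nat.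
by congr (gbinom _ _ - gbinom _ _); rewrite -!natr1 !natrD -?natr1; ring.
Qed.

(** * The exchange identity for G-matrices *)

Lemma exists_perm_mapping2 (T : finType) (i k j l : T) :
  i != k -> j != l -> exists s : {perm T}, s i = j /\ s k = l.
Proof.
(* The first factor sends [i] to [j]; the second moves the image of [k] to [l] and fixes [j], which
   differs from both. *)
move=> ik jl; exists (tperm i j * tperm (tperm i j k) l)%g.
rewrite !permM tpermL; split; last by rewrite tpermL.
rewrite tpermD //; last by rewrite eq_sym.
by rewrite -{2}(tpermL i j) (inj_eq perm_inj) eq_sym.
Qed.

(** The permutations [s] and [tperm i k * s] agree off [i] and [k], so all other summands of their
    equal sums cancel. *)
Lemma G_matrix_exchange (R : realType) (d : nat) (N : R) (A : 'M[R]_d) i j k l :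
  G_matrix N A -> A i j + A k l = A i l + A k j.
Proof.
move=> [_ A_sum].
have [->|ik] := eqVneq i k; first by rewrite addrC.
have [->//|jl] := eqVneq j l.
have [s [si sk]] := exists_perm_mapping2 _ _ _ _ _ ik jl.
have := A_sum s; rewrite -(A_sum (tperm i k * s)%g).
rewrite !(bigD1 i (P := xpredT)) //= !(bigD1 k (P := fun z => z != i)) 1?eq_sym //=.
rewrite !permM tpermL tpermR si sk.
rewrite [X in _ = _ + (_ + X)](eq_bigr (fun z => A z (s z))).
  by rewrite !addrA => /addIr.
by move=> z /andP[zi zk]; rewrite permM tpermD // eq_sym.
Qed.

(** * Counting weak compositions *)

(* The first d.+1 components are the row parts r, the last d.+1 the column
   parts c. *)
Definition weak_compositions (d N : nat) : {set (d.+1 + d.+1).-tuple 'I_N.+1} :=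
  [set t : (d.+1 + d.+1).-tuple 'I_N.+1 | \sum_(i <- t) i == N]%N.

Lemma weak_compositionsP (d N : nat) (t : (d.+1 + d.+1).-tuple 'I_N.+1) :
  (t \in weak_compositions d N)
  = (\sum_(i < d.+1) tnth t (lshift _ i) + \sum_(i < d.+1) tnth t (rshift _ i)
     == N)%N.
Proof. by rewrite inE big_tuple big_split_ord. Qed.

(** Stars and bars: [d.+1 + d.+1] parts are separated by [d + d.+1] bars. *)
Lemma card_weak_compositions (d N : nat) :
  #|weak_compositions d N| = 'C(N + (d + d.+1), d + d.+1).
Proof. by rewrite addnC -card_ord_partitions. Qed.

Definition positive_left (d N : nat) (t : (d.+1 + d.+1).-tuple 'I_N.+1) : bool :=
  [forall i : 'I_d.+1, (0 < tnth t (lshift _ i))%N].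

(** Lowering each row part by 1 is a bijection onto the weak compositions of [N - d.+1]; for
    [N < d.+1] both sides are 0. *)
Lemma card_positive_left (d N : nat) :
  #|[set t in weak_compositions d N | @positive_left d N t]|
  = 'C(N + d, d + d.+1).
Proof.
have [Nd|dN] := ltnP N d.+1.
  rewrite bin_small; last by lia.
  apply: eq_card0 => t; rewrite inE.
  apply/negP => /andP[]; rewrite weak_compositionsP => /eqP tN /forallP t_gt0.
  suff : (d.+1 <= N)%N by lia.
  rewrite -tN -[X in (X <= _)%N]card_ord -sum1_card.
  by apply: leq_trans (leq_addr _ _); apply: leq_sum => i _; apply: t_gt0.
have [M ->] : exists M, (N = M + d.+1)%N by exists (N - d.+1)%N; lia.
pose f (t : (d.+1 + d.+1).-tuple 'I_M.+1) : (d.+1 + d.+1).-tuple 'I_(M + d.+1).+1 :=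
  [tuple inord (tnth t i + (i < d.+1)) | i < d.+1 + d.+1].
have fE t i : tnth (f t) i = (tnth t i + (i < d.+1))%N :> nat.
  rewrite tnth_mktuple inordK //.
  by have := ltn_ord (tnth t i); case: (i < d.+1)%N; lia.
have f_inj : injective f.
  move=> t u ftu; apply/eq_from_tnth => i; apply: val_inj.
  by have := fE t i; rewrite ftu fE => /addIn.
have fl t (i : 'I_d.+1) : tnth (f t) (lshift _ i) = (tnth t (lshift _ i)).+1 :> nat.
  by rewrite fE /= ltn_ord addn1.
have fr t (i : 'I_d.+1) : tnth (f t) (rshift _ i) = tnth t (rshift _ i) :> nat.
  by rewrite fE /= ltnNge leq_addr addn0.
have f_sum t : (f t \in weak_compositions d (M + d.+1)) = (t \in weak_compositions d M).
  rewrite !weak_compositionsP.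
  under eq_bigr do rewrite fl -addn1.
  under [X in (_ + X)%N]eq_bigr do rewrite fr.
  by rewrite big_split /= sum_nat_const card_ord muln1 addnAC eqn_add2r.
transitivity #|f @: weak_compositions d M|.
  apply: eq_card => u; rewrite inE; apply/andP/imsetP => [[uS /forallP u_gt0]|[t tS ->]].
    have u_ge (i : 'I_(d.+1 + d.+1)) : ((i < d.+1) <= tnth u i)%N.
      case: (ltnP i d.+1) => // id.
      by have := u_gt0 (Ordinal id); congr (0 < tnth u _)%N; apply: val_inj.
    have u_sum : (\sum_(i < d.+1 + d.+1) (tnth u i - (i < d.+1)) = M)%N.
      apply: (@addIn d.+1).
      rewrite -[RHS](eqP (etrans (esym (weak_compositionsP _ _ _)) uS)).
      rewrite big_split_ord /= addnAC; congr (_ + _)%N; last first.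
        by apply: eq_bigr => i _; rewrite ltnNge leq_addr subn0.
      transitivity (\sum_(i < d.+1) (tnth u (lshift _ i) - 1 + 1))%N.
        rewrite big_split /= sum_nat_const card_ord muln1; congr (_ + _)%N.
        by apply: eq_bigr => i _; rewrite ltn_ord.
      by apply: eq_bigr => i _; rewrite subnK.
    (* A lowered component is at most the total [M], so the preimage lives in the smaller ordinal
       type. *)
    have u_le (i : 'I_(d.+1 + d.+1)) : (tnth u i - (i < d.+1) < M.+1)%N.
      by rewrite ltnS -[X in (_ <= X)%N]u_sum (bigD1 i) //= leq_addr.
    have uf : f [tuple Ordinal (u_le i) | i < d.+1 + d.+1] = u.
      apply/eq_from_tnth => i; apply: val_inj; rewrite /= fE tnth_mktuple /=.
      by rewrite subnK.
    exists [tuple Ordinal (u_le i) | i < d.+1 + d.+1] => //.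
    by rewrite -f_sum uf.
  by split; [rewrite f_sum | apply/forallP => i; rewrite fl].
rewrite card_imset // card_weak_compositions.
by congr ('C(_, _)); lia.
Qed.

(** * Integral G-matrices as sums of row and column parts *)

Definition border_sum_matrix (R : realType) (d N : nat)
    (t : (d.+1 + d.+1).-tuple 'I_N.+1) : 'M[R]_d.+1 :=
  \matrix_(i, j) (tnth t (lshift _ i) + tnth t (rshift _ j))%:R.

(** Some row part is 0: this selects one pair among those that differ by moving a constant between
    rows and columns. *)
Definition normalized_compositions (d N : nat) :
    {set (d.+1 + d.+1).-tuple 'I_N.+1} :=
  [set t in weak_compositions d N | ~~ positive_left d N t].

Lemma card_normalized_compositions (R : realType) (d N : nat) :
  #|normalized_compositions d N|%:R
  = 'C(N + (d + d.+1), d + d.+1)%:R - 'C(N + d, d + d.+1)%:R :> R.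
Proof.
rewrite -card_weak_compositions -card_positive_left.
rewrite -(cardsID [set t | positive_left d N t] (weak_compositions d N)).
rewrite setIdE natrD addrAC subrr add0r.
by congr (_%:R); apply: eq_card => t; rewrite !inE andbC.
Qed.

Lemma border_sum_matrix_inj (R : realType) (d N : nat) :
  {in normalized_compositions d N &, injective (border_sum_matrix R d N)}.
Proof.
move=> t u; rewrite !inE => /andP[_ /forallPn[i0 ti0]] /andP[_ /forallPn[i1 ui1]].
move=> /matrixP tu.
have E i j : (tnth t (lshift _ i) + tnth t (rshift _ j)
              = tnth u (lshift _ i) + tnth u (rshift _ j))%N.
  by have := tu i j; rewrite !mxE => /eqP; rewrite eqr_nat => /eqP.
(* A zero row part of [t] gives one inequality between the column parts, and a zero row part of [u]
   gives the reverse one. *)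
have Er j : tnth t (rshift _ j) = tnth u (rshift _ j) :> nat.
  have := E i0 j; have := E i1 j; move: ti0 ui1; rewrite -!eqn0Ngt.
  by move=> /eqP-> /eqP->; lia.
apply/eq_from_tnth => k; apply: val_inj => /=; case: (split_ordP k) => j ->.
  by have := E j ord0; rewrite Er => /addIn.
exact: Er.
Qed.

Lemma border_sum_matrix_G (R : realType) (d N : nat) t :
  t \in weak_compositions d N -> @integral_G_matrices R d.+1 N (border_sum_matrix R d N t).
Proof.
rewrite weak_compositionsP => /eqP tN; split=> [|i j]; last by rewrite mxE natr_int.
split=> [i j|s]; first by rewrite mxE ler0n.
under eq_bigr do rewrite mxE.
rewrite -natr_sum big_split /= -[in RHS]tN; congr (_ + _)%:R.
by rewrite [RHS](reindex_inj (@perm_inj _ s)).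
Qed.

Lemma integral_G_matrix_border_sum (R : realType) (d N : nat) (A : 'M[R]_d.+1) :
  @integral_G_matrices R d.+1 N A ->
  exists2 t, t \in normalized_compositions d N & A = border_sum_matrix R d N t.
Proof.
move=> [A_G A_int]; have [A_ge0 A_sum] := A_G.
pose a i j := Num.Def.trunc (A i j).
have aE i j : A i j = (a i j)%:R.
  by apply/esym/eqP; rewrite -natrEtruncn natrEint A_int A_ge0.
have a_exch i j k l : (a i j + a k l = a i l + a k j)%N.
  apply/eqP; rewrite -(eqr_nat R) !natrD -!aE; apply/eqP.
  exact: G_matrix_exchange A_G.
have a_sum : (\sum_i a i i = N)%N.
  apply/eqP; rewrite -(eqr_nat R) natr_sum -(A_sum 1%g); apply/eqP.
  by apply: eq_bigr => i _; rewrite perm1 aE.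
have a_le i : (a i i <= N)%N by rewrite -a_sum (bigD1 i) //= leq_addr.
(* By exchange, two rows differ by a constant, so the row [i0] that is least in column 0 is least in
   every column. It supplies the column parts, and the excess over it the row parts. *)
case: (@arg_minnP _ ord0 xpredT (fun i => a i ord0) isT) => i0 _ a_min.
pose r i := (a i ord0 - a i0 ord0)%N.
have rcE i j : (r i + a i0 j = a i j)%N.
  by have := a_exch i ord0 i0 j; have := a_min i isT; rewrite /r; lia.
(* Both bounds come from the diagonal: [r i + a i0 i = a i i <= N]. *)
have r_lt i : (r i < N.+1)%N by have := a_le i; rewrite -rcE; lia.
have c_lt j : (a i0 j < N.+1)%N by have := a_le j; rewrite -rcE; lia.
pose t : (d.+1 + d.+1).-tuple 'I_N.+1 :=
  [tuple match fintype.split k with inl i => Ordinal (r_lt i) | inr j => Ordinal (c_lt j) end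
  | k < d.+1 + d.+1].
have tl i : tnth t (lshift _ i) = r i :> nat.
  by rewrite tnth_mktuple (unsplitK (inl i)).
have tr j : tnth t (rshift _ j) = a i0 j :> nat.
  by rewrite tnth_mktuple (unsplitK (inr j)).
exists t; last by apply/matrixP => i j; rewrite mxE tl tr rcE aE.
rewrite inE weak_compositionsP; apply/andP; split.
  rewrite -big_split /= -[X in _ == X]a_sum; apply/eqP/eq_bigr => i _.
  by rewrite tl tr rcE.
by apply/forallPn; exists i0; rewrite tl /r subnn.
Qed.

Lemma g_eq_card (R : realType) (d N : nat) :
  g R d.+1 N = #|normalized_compositions d N|.
Proof.
pose S := normalized_compositions d N.
rewrite /g.
have -> : @integral_G_matrices R d.+1 N
  = [set` [fset border_sum_matrix R d N t | t in S]%fset]%classic.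
  apply/seteqP; split=> A /=.
    by move/integral_G_matrix_border_sum => [t tS ->]; apply/imfsetP; exists t.
  move/imfsetP => [t /= + ->]; rewrite inE => /andP[tW _].
  exact: border_sum_matrix_G.
rewrite set_fsetK card_in_imfset /=; last exact: border_sum_matrix_inj.
by rewrite cardE.
Qed.

Theorem mainTheorem4 (R : realType) (d : nat) (hd : (1 <= d)%N) (N : nat) :
  (g R d N)%:R =
    \sum_(1 <= m < 2 * d)
      (gbinom (2 * d)%:R m%:Z - gbinom d%:R (m%:Z - d%:Z))
      * gbinom (N%:R - 1) (m%:Z - 1) :> R.
Proof.
case: d hd => // d _.
by rewrite gbinom_sum_closed_form g_eq_card card_normalized_compositions.
Qed.
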